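(* Let $X$ be a non-negative absolutely continuous random variable with distribution function $F$, density $f$ and reversed hazard rate $\lambda(t)=f(t)/F(t)$, and let $\mu>0$. Then $X$ has an exponential distribution with mean $\mu$ if and only if, for $s\ge 1$ and all $t>0$, $$\bar B_s(F;t)=\mu\,(\lambda(t))^s\,\frac{e^{st/\mu}-1}{s}.$$
   Context: The past entropy generating function is $\bar B_s(F;t)=\int_0^t\left(\frac{f(x)}{F(t)}\right)^s dx$, $s\ge 1$, for $t$ with $F(t)>0$. *)

(* Defs.v *)
From HB Require Import structures.
From mathcomp Require Import all_boot all_order all_algebra.
From mathcomp Require Import all_classical all_reals all_analysis.
Set Implicit Arguments. Unset Strict Implicit. Unset Printing Implicit Defensive.
Import Order.TTheory GRing.Theory Num.Theory.
Local Open Scope classical_set_scope.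
Local Open Scope ring_scope.

Definition distF {R : realType} (f : R -> R) (t : R) : R :=
  fine (\int[@lebesgue_measure R]_(x in `]-oo, t]) (f x)%:E).

Definition rev_hazard {R : realType} (f : R -> R) (t : R) : R :=
  f t / distF f t.

(* past entropy generating function  B_s(F;t) = int_0^t (f(x)/F(t))^s dx
   (extended-real valued: may be +oo if not integrable) *)
Definition past_entropy_gf {R : realType} (f : R -> R) (s t : R) : \bar R :=
  \int[@lebesgue_measure R]_(x in `[0, t]) ((f x / distF f t) `^ s)%:E.

(* Main.v *)
(** With g = f^s and G(t) = int_0^t g, the powers of F(t) cancel and the identity
    reads a G(t) = g(t) (e^(at) - 1), a = s / mu, wherever F(t) > 0; since f and f^s
    have the same null sets, F(t) > 0 is the same condition as G(t) > 0. There the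
    equation makes g continuous, so G' = g and G(t) / (1 - e^(-at)) has zero
    derivative. This quotient is therefore constant from any point where G > 0
    onwards, so by the intermediate value theorem it cannot climb from 0: G > 0 on
    the whole half-line. Hence f is a multiple of e^(-t/mu) there, and the total
    mass fixes the factor. *)
Require Import Defs.
From HB Require Import structures.
From mathcomp Require Import all_boot all_order all_algebra ring lra.
From mathcomp Require Import all_classical all_reals all_analysis.
From mathcomp Require Import measurable_realfun.
Import Order.TTheory GRing.Theory Num.Theory.
Import numFieldNormedType.Exports.
Local Open Scope classical_set_scope.
Local Open Scope ring_scope.

Lemma continuous_expRM (R : realType) (c : R) : continuous (fun x : R => expR (c * x)).
Proof.
move=> x; apply: continuous_comp; last exact: continuous_expR.
exact: mulrl_continuous.
Qed.

(** * The equation a G = g (e^(at) - 1) for a primitive G of g *)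

Section PrimitiveEquation.
Context (R : realType) (g : R -> R) (a T : R).
Let mu := @lebesgue_measure R.
Let G (t : R) := (\int[mu]_(x in `[0%R, t]) g x)%R.
(** The exponential distribution function with rate [a]; the solutions G turn out to be its
    multiples. *)
Let E (t : R) : R := 1 - expR (- a * t).
Hypothesis a0 : 0 < a.
Hypothesis g0 : forall x, 0 <= g x.
Hypothesis gint : forall t, mu.-integrable `[0, t] (EFin \o g).
Hypothesis eqG : forall t : R, 0 < t -> 0 < G t ->
  g t * (expR (a * t) - 1) = a * G t.
Hypothesis T0 : 0 < T.
Hypothesis GT0 : 0 < G T.

Let G_continuous (x : R) : 0 < x -> {for x, continuous G}.
Proof.
move=> x0.
have x1 : 0 < x + 1 by rewrite addr_gt0.
have := @parameterized_integral_continuous R 0 (x + 1) g (ltW x1) (gint (x + 1)).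
move=> /(continuous_within_itvP _ x1)[+ _ _].
by apply; rewrite in_itv/= x0 ltrDl ltr01.
Qed.

Let E_gt0 (x : R) : 0 < x -> 0 < E x.
Proof. by move=> x0; rewrite subr_gt0 expR_lt1 mulNr oppr_lt0 mulr_gt0. Qed.

Let G_nondecreasing (x y : R) : x <= y -> G x <= G y.
Proof.
move=> xy; rewrite /G /Rintegral fine_le//.
- exact: integrable_fin_num.
- exact: integrable_fin_num.
- apply: ge0_subset_integral => //.
  + exact: (measurable_int _ (gint y)).
  + by move=> z _; rewrite lee_fin.
  + by apply: subset_itvl; rewrite bnd_simp.
Qed.

Let gE (x : R) : 0 < x -> 0 < G x -> g x = a * G x / (expR (a * x) - 1).
Proof.
move=> x0 Gx; rewrite -eqG// mulfK// gt_eqF// subr_gt0 expR_gt1 mulr_gt0//.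
Qed.

Let G_derive (x : R) : 0 < x -> 0 < G x -> is_derive x 1 G (g x).
Proof.
move=> x0 Gx.
(* [q] is the equation solved for g. It is continuous because G is, and it agrees with g near [x]
   since G stays positive there; so g is continuous at [x] and the fundamental theorem of calculus
   applies. *)
pose q (y : R) := a * G y / (expR (a * y) - 1).
have qc : {for x, continuous q}.
  apply: continuousM.
    by apply: continuousM; [exact: cst_continuous|exact: G_continuous].
  apply: continuousV; first by rewrite gt_eqF// subr_gt0 expR_gt1 mulr_gt0.
  apply: continuousB; last exact: cst_continuous.
  exact: continuous_expRM.
have gc : {for x, continuous g}.
  rewrite /prop_for /continuous_at (gE _ x0 Gx).
  apply: cvg_trans qc; apply: near_eq_cvg; near=> y.
  rewrite /q -gE//; near: y; first exact: lt_nbhsr.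
  exact: (cvgr_gt (G x) (G_continuous x x0)).
have [dG <-] := @continuous_FTC1_closed R g 0 x (x + 1)
  (ltr_pwDr ltr01 (lexx x)) (gint _) x0 gc.
by rewrite derive1E; exact: derivableP.
Unshelve. all: by end_near. Qed.

Let H (t : R) := G t / E t.

Let H_continuous (x : R) : 0 < x -> {for x, continuous H}.
Proof.
move=> x0; apply: continuousM; first exact: G_continuous.
apply: continuousV; first by rewrite gt_eqF// E_gt0.
apply: continuousB; first exact: cst_continuous.
exact: continuous_expRM.
Qed.

Let H_continuous_within (x y : R) : 0 < x -> {within `[x, y], continuous H}.
Proof.
move=> x0; apply: continuous_in_subspaceT => z.
by rewrite inE/= in_itv/= => /andP[xz _]; apply: H_continuous; exact: lt_le_trans xz.
Qed.

(** Since E'/E = a / (e^(ax) - 1), the equation says G'/G = E'/E, so the quotient is stationary. *)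
Let H_derive (x : R) : 0 < x -> 0 < G x -> is_derive x 1 H 0.
Proof.
move=> x0 Gx.
have dG := G_derive _ x0 Gx.
have Ex := E_gt0 _ x0.
have dE : is_derive x 1 E (a * expR (- a * x)).
  rewrite /E; apply: is_derive_eq.
  by rewrite scaler1; ring.
have dV := is_deriveV (lt0r_neq0 Ex) dE.
apply: (@is_derive_eq _ _ _ _ _ _ _ _ (is_deriveM dG dV)).
have e1 : expR (a * x) - 1 != 0 by rewrite gt_eqF// subr_gt0 expR_gt1 mulr_gt0.
have e0 : expR (a * x) != 0 by rewrite gt_eqF// expR_gt0.
rewrite gE// /E mulNr expRN /GRing.scale/=.
by field; rewrite e1 e0.
Qed.

(** Monotonicity of G carries positivity from [x] to all of [x, y], where the mean value theorem
    then applies with zero derivative. *)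
Let H_cst (x y : R) : 0 < x -> 0 < G x -> x <= y -> H y = H x.
Proof.
move=> x0 Gx xy.
have [z|c _ /eqP] := @MVT_segment _ H (cst 0) x y xy _ (H_continuous_within _ _ x0).
  rewrite in_itv/= => /andP[xz _]; apply: H_derive.
    exact: lt_trans xz.
  by apply: (lt_le_trans Gx); apply: G_nondecreasing; exact: ltW.
by rewrite mul0r subr_eq0 => /eqP.
Qed.

Let G_gt0 (t : R) : 0 < t -> 0 < G t.
Proof.
move=> t0; rewrite lt_neqAle Rintegral_ge0 ?andbT//; apply/eqP => Gt.
have [tT|Tt] := leP t T; last first.
  by have := G_nondecreasing _ _ (ltW Tt); rewrite -Gt leNgt GT0.
have HT : 0 < H T by rewrite divr_gt0// E_gt0.
have Ht : H t = 0 by rewrite /H -Gt mul0r.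
(* Any value strictly between 0 and [H T] would do: at such a [c], G is positive, so [H_cst] forces
   [H c = H T]. *)
have [|c] := @IVT _ H t T (H T / 2) tT (H_continuous_within _ _ t0).
  by rewrite Ht min_l ?max_r ?(ltW HT)//; lra.
rewrite in_itv/= => /andP[tc cT] Hc.
have c0 : 0 < c by exact: lt_le_trans tc.
have Gc : 0 < G c.
  have : 0 < H c by rewrite Hc divr_gt0.
  by rewrite pmulr_lgt0// invr_gt0 E_gt0.
have := H_cst _ _ c0 Gc cT; rewrite Hc; lra.
Qed.

Lemma primitive_equation_exponential :
  exists K, forall t : R, 0 < t -> g t = K * (a * expR (- a * t)).
Proof.
(* K is the common value of [H]; then g = a H E / (e^(at) - 1) = K a e^(-at). *)
exists (H T) => t t0.
have Gt := G_gt0 _ t0.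
have -> : H T = H t.
  have [/(H_cst _ _ t0 Gt)//|/ltW /(H_cst _ _ T0 GT0)//] := leP t T.
rewrite gE// /H /E mulNr expRN.
have e1 : expR (a * t) - 1 != 0 by rewrite gt_eqF// subr_gt0 expR_gt1 mulr_gt0.
have e0 : expR (a * t) != 0 by rewrite gt_eqF// expR_gt0.
by field; rewrite e0 e1.
Qed.
End PrimitiveEquation.

(** * Integrals of powers and of multiples of the exponential density *)

Lemma integral_powR_eq0 {d} {T : measurableType d} {R : realType}
    (m : {measure set T -> \bar R}) (D : set T) (f : T -> R) (s : R) :
  d.-measurable D -> measurable_fun D f -> (forall x, 0 <= f x) -> s != 0 ->
  (\int[m]_(x in D) (f x `^ s)%:E == 0)%E = (\int[m]_(x in D) (f x)%:E == 0)%E.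
Proof.
move=> mD mf f0 s0.
have mfs : measurable_fun D (fun x => f x `^ s).
  exact: (measurableT_comp (measurable_powR s)).
have int0 (g : T -> R) : measurable_fun D g -> (forall x, 0 <= g x) ->
    (\int[m]_(x in D) (g x)%:E = 0)%E <-> ae_eq m D (EFin \o g) (cst 0%E).
  move=> mg g0; rewrite -ae_eq_integral_abs//; last exact/measurable_EFinP.
  by under eq_integral do rewrite -[(g _)%:E]gee0_abs ?lee_fin//.
have fs0 x : 0 <= f x `^ s by exact: powR_ge0.
apply/eqP/eqP => [/(int0 _ mfs fs0) h|/(int0 _ mf f0) h].
  apply/(int0 _ mf f0); apply: filterS h => x /= /[apply] -[] h.
  by rewrite (powR_eq0_eq0 h).
apply/(int0 _ mfs fs0); apply: filterS h => x /= /[apply] -[] h.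
by rewrite h powR0.
Qed.

(** The integrands can differ only at the origin, a null set. This serves both for f^s on [0, t] and
    for f on the whole line. *)
Lemma integral_exponential_scale {R : realType} (D : set (measurableTypeR R))
    (h : R -> R) (c a : R) :
  measurable D -> measurable_fun setT h -> 0 <= a -> 0 <= c ->
  (forall x, x < 0 -> h x = 0) ->
  (forall x, 0 < x -> h x = c * (a * expR (- a * x))) ->
  (\int[@lebesgue_measure R]_(x in D) (h x)%:E
   = c%:E * \int[@lebesgue_measure R]_(x in D) (exponential_pdf a x)%:E)%E.
Proof.
move=> mD mh a0 c0 hneg hpos.
have mpdf : measurable_fun D (EFin \o exponential_pdf a).
  apply/measurable_EFinP; apply: measurable_funTS.
  exact: measurable_exponential_pdf.
rewrite -ge0_integralZl//; last first.
  by move=> x _; rewrite lee_fin exponential_pdf_ge0.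
apply: ae_eq_integral => //.
- by apply/measurable_EFinP; exact: measurable_funTS.
- exact: measurable_funeM.
exists [set 0]; split => //; first exact: lebesgue_measure_set1.
move=> x /= /not_implyP[_ hx]; apply: contrapT => /eqP; rewrite neq_lt => /orP[x0|x0].
  by apply: hx; rewrite hneg// lt0_exponential_pdf// mule0.
by apply: hx; rewrite hpos// exponential_pdfE ?ltW.
Qed.

(** * From the past entropy identity to the equation for f^s and back *)

Section PastEntropy.
Context (R : realType) (f : R -> R) (mu s : R).
Hypothesis mf : measurable_fun setT f.
Hypothesis f0 : forall x, 0 <= f x.
Hypothesis fneg : forall x, x < 0 -> f x = 0.
Hypothesis f1 : (\int[@lebesgue_measure R]_x (f x)%:E = 1)%E.
Hypothesis mu0 : 0 < mu.
Hypothesis s1 : 1 <= s.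

Let s0 : 0 < s. Proof. exact: lt_le_trans s1. Qed.

Let mfs : measurable_fun setT (fun x => f x `^ s).
Proof. exact: (measurableT_comp (measurable_powR s)). Qed.

Lemma past_entropy_gf_scale (t : R) : 0 < distF f t ->
  past_entropy_gf f s t = ((distF f t `^ s)^-1%:E *
    \int[@lebesgue_measure R]_(x in `[0%R, t]) (f x `^ s)%:E)%E.
Proof.
move=> Ft; rewrite -ge0_integralZl//.
- apply: eq_integral => x _; rewrite -EFinM powRM// ?invr_ge0 ?ltW//.
  (* Writing the inverse as the power -1 lets the two exponents be exchanged. *)
  by rewrite -powR_inv1 ?ltW// powRAC powR_inv1 ?powR_ge0// mulrC.
- by apply/measurable_EFinP; exact: measurable_funTS mfs.
- by move=> x _; rewrite lee_fin powR_ge0.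
- by rewrite lee_fin invr_ge0 powR_ge0.
Qed.

(** Both sides carry the factor F(t)^(-s), which is finite and nonzero and so cancels even if the
    integral is infinite. *)
Lemma past_entropy_gf_eqE (t : R) : 0 < distF f t ->
  past_entropy_gf f s t
    = (mu * (rev_hazard f t) `^ s * (expR (s * t / mu) - 1) / s)%:E <->
  (\int[@lebesgue_measure R]_(x in `[0%R, t]) (f x `^ s)%:E
    = (mu * f t `^ s * (expR (s * t / mu) - 1) / s)%:E)%E.
Proof.
move=> Ft; rewrite past_entropy_gf_scale//.
have Fs : distF f t `^ s != 0 by rewrite gt_eqF// powR_gt0.
rewrite /rev_hazard powRM// ?invr_ge0 ?ltW//.
rewrite -[(distF f t)^-1]powR_inv1 ?ltW// [(_ `^ (-1)) `^ s]powRAC.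
rewrite powR_inv1 ?powR_ge0//; split=> [|->]; last first.
  by rewrite -EFinM; congr EFin; field; rewrite Fs gt_eqF.
move=> /(congr1 (fun z => (distF f t `^ s)%:E * z)%E).
rewrite muleA -!EFinM mulfV// mul1e => ->.
by congr EFin; field; rewrite Fs gt_eqF.
Qed.

Lemma integral_distF (t : R) :
  (\int[@lebesgue_measure R]_(x in `]-oo, t]) (f x)%:E
   = \int[@lebesgue_measure R]_(x in `[0%R, t]) (f x)%:E)%E.
Proof.
rewrite integral_mkcond [RHS]integral_mkcond; congr integral.
apply/funext => x; rewrite !patchE.
have -> : (x \in `[0, t]%classic) = (0 <= x) && (x \in `]-oo, t]%classic).
  by rewrite !mem_setE !in_itv.
by case: leP => //= x0; rewrite fneg//; case: ifP.
Qed.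

(** [fine] sends infinite values to 0, so finiteness is what lets [distF] be compared with the
    integral; the total mass 1 bounds it. *)
Lemma distF_fin_num (t : R) :
  (\int[@lebesgue_measure R]_(x in `]-oo, t]) (f x)%:E)%E \is a fin_num.
Proof.
rewrite ge0_fin_numE; last by apply: integral_ge0 => x _; rewrite lee_fin.
apply: le_lt_trans (ltry 1); rewrite -f1.
by apply: ge0_subset_integral => //; [exact/measurable_EFinP|
  move=> x _; rewrite lee_fin].
Qed.

Lemma distF_gt0E (t : R) : (0 < distF f t) =
  (\int[@lebesgue_measure R]_(x in `[0%R, t]) (f x `^ s)%:E != 0)%E.
Proof.
rewrite integral_powR_eq0//; last 2 first.
- exact: measurable_funTS.
- by rewrite gt_eqF.
rewrite -integral_distF lt_neqAle fine_ge0 ?andbT; last first.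
  by apply: integral_ge0 => x _; rewrite lee_fin.
by rewrite eq_sym fine_eq0// distF_fin_num.
Qed.

(** By monotone convergence F(n) tends to the total mass 1, so some F(n) is positive. *)
Lemma distF_gt0_near_pinfty : exists2 T : R, 0 < T &
  forall t, T <= t -> 0 < distF f t.
Proof.
have mono : {homo (fun n : nat => `]-oo, n%:R]%classic : set R) :
    n m / (n <= m)%N >-> (n <= m)%O}.
  move=> n m nm; rewrite subsetEset; apply: subset_itvl.
  by rewrite bnd_simp ler_nat.
have mfE (D : set R) : measurable_fun D (EFin \o f).
  by apply/measurable_EFinP; exact: measurable_funTS.
have : (\int[@lebesgue_measure R]_(x in `]-oo, n%:R]) (f x)%:E)%E @[n --> \oo]
    --> (\int[@lebesgue_measure R]_(x in \bigcup_n `]-oo, n%:R]%classic) (f x)%:E)%E.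
  apply: (@ge0_nondecreasing_set_cvg_integral _ (measurableTypeR R) R
    (fun n : nat => `]-oo, n%:R]%classic) (EFin \o f) (@lebesgue_measure R) mono).
  - by move=> n; exact: measurable_itv.
  - by move=> n; exact: mfE.
  - by move=> n x _; rewrite lee_fin.
have -> : \bigcup_n `]-oo, n%:R]%classic = [set: R].
  apply/seteqP; split => // x _; exists (Num.truncn x).+1 => //=.
  by rewrite in_itv/= ltW// truncnS_gt.
rewrite f1 => cv.
have [n Fn] : exists n : nat, 0 < distF f n%:R.
  apply: contrapT => /forallNP F0.
  have : (fun n : nat => \int[@lebesgue_measure R]_(x in `]-oo, n%:R])
      (f x)%:E)%E = cst 0%E.
    apply/funext => n; have := F0 n; rewrite lt_neqAle fine_ge0; last first.
      by apply: integral_ge0 => x _; rewrite lee_fin.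
    by rewrite andbT eq_sym fine_eq0 ?distF_fin_num// => /negP/negPn/eqP.
  move=> F0'; move: cv; rewrite F0' => /cvg_lim; rewrite lim_cst//.
  by move=> /(_ (@ereal_hausdorff _))/eqP; rewrite eq_sym onee_eq0.
(* The successor keeps the witness positive when [n] is 0. *)
exists n.+1%:R => // t nt; apply: (lt_le_trans Fn).
rewrite /distF fine_le ?distF_fin_num//.
apply: ge0_subset_integral => //; first exact: mfE.
  by move=> x _; rewrite lee_fin.
by apply: subset_itvl; rewrite bnd_simp (le_trans _ nt)// ler_nat.
Qed.

(** f^s is a multiple of the exponential density with rate s / mu, whose mass on [0, t] is 1 -
    e^(-st/mu). *)
Lemma exponential_past_entropy :
  (forall x, 0 < x -> f x = mu^-1 * expR (- x / mu)) ->
  forall t, 0 < t -> 0 < distF f t ->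
      past_entropy_gf f s t
      = (mu * (rev_hazard f t) `^ s * (expR (s * t / mu) - 1) / s)%:E.
Proof.
move=> fE t t0 Ft; apply/past_entropy_gf_eqE => //.
have fsE x : 0 < x ->
    f x `^ s = (mu^-1 `^ s / (s / mu)) * (s / mu * expR (- (s / mu) * x)).
  move=> x0; rewrite fE// powRM ?expR_ge0 ?invr_ge0 ?ltW// -expRM.
  have -> : - x / mu * s = - (s / mu) * x by ring.
  by field; rewrite !gt_eqF.
rewrite (@integral_exponential_scale _ _ _ (mu^-1 `^ s / (s / mu)) (s / mu))//.
- have := @exponential_prob_itv0c R (s / mu) t t0; rewrite /exponential_prob => ->.
  rewrite -EFinD -EFinM fsE//; congr EFin.
  have -> : s * t / mu = s / mu * t by ring.
  have e0 : expR (s / mu * t) != 0 by rewrite gt_eqF// expR_gt0.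
  by rewrite mulNr expRN; field; rewrite e0 !gt_eqF.
- by rewrite divr_ge0 ?ltW.
- by rewrite !divr_ge0 ?powR_ge0 ?ltW.
- by move=> x x0; rewrite fneg// powR0// gt_eqF.
Qed.

Lemma past_entropy_exponential :
  (forall t, 0 < t -> 0 < distF f t ->
      past_entropy_gf f s t
      = (mu * (rev_hazard f t) `^ s * (expR (s * t / mu) - 1) / s)%:E) ->
  forall x, 0 < x -> f x = mu^-1 * expR (- x / mu).
Proof.
move=> Bs.
pose g x := f x `^ s; pose a := s / mu.
have a0 : 0 < a by rewrite divr_gt0.
have g0 x : 0 <= g x by exact: powR_ge0.
have intE t : 0 < t -> 0 < distF f t ->
    (\int[@lebesgue_measure R]_(x in `[0%R, t]) (g x)%:E
     = (g t * (expR (a * t) - 1) / a)%:E)%E.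
  move=> t0 Ft; have /past_entropy_gf_eqE-> // := Bs _ t0 Ft.
  have -> : s * t / mu = a * t by rewrite /a; ring.
  by congr EFin; rewrite /a /g; field; rewrite !gt_eqF.
have [T T0 FT] := distF_gt0_near_pinfty.
have mg (D : set R) : measurable_fun D g by exact: measurable_funTS mfs.
have gint t : (@lebesgue_measure R).-integrable `[0, t] (EFin \o g).
  (* On the larger interval F is positive at the right end, so the identity itself gives the
     integral a finite value. *)
  apply: (@integrableS _ (measurableTypeR R) R _ `[0%R, Num.max t T]%classic) => //.
    by apply: subset_itvl; rewrite bnd_simp le_max lexx.
  apply/integrableP; split; first by apply/measurable_EFinP; exact: mg.
  under eq_integral do rewrite /= ger0_norm//.
  by rewrite intE ?ltry ?FT// ?lt_max ?le_max ?lexx ?T0 ?orbT.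
have Gt0 t : (0 < \int[@lebesgue_measure R]_(x in `[0, t]) g x) = (0 < distF f t).
  rewrite distF_gt0E lt_neqAle Rintegral_ge0 ?andbT//.
  rewrite eq_sym fine_eq0//; exact: integrable_fin_num.
have [||K gK] := @primitive_equation_exponential R g a T a0 g0 gint _ T0 _.
- move=> t t0; rewrite Gt0 => Ft.
  by rewrite /Rintegral intE//=; field; rewrite gt_eqF.
- by rewrite Gt0 FT.
have K0 : 0 <= K.
  by have := g0 1; rewrite gK// pmulr_lge0// mulr_gt0// expR_gt0.
(* Taking s-th roots of g = K a e^(-ax) gives f = (K a)^(1/s) e^(-x/mu); [A] is its ratio to the
   density of mean [mu]. *)
pose A := (K * a) `^ s^-1 * mu.
have A0 : 0 <= A by rewrite mulr_ge0 ?powR_ge0 ?ltW.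
have fA x : 0 < x -> f x = A * (mu^-1 * expR (- mu^-1 * x)).
  move=> x0; have -> : f x = g x `^ s^-1.
    by rewrite -powRrM mulfV ?gt_eqF// powRr1.
  rewrite gK// mulrA powRM ?expR_ge0 ?(mulr_ge0 K0 (ltW a0))//.
  rewrite -expRM /A.
  have -> : - a * x * s^-1 = - mu^-1 * x by rewrite /a; field; rewrite !gt_eqF.
  by field; rewrite gt_eqF.
have : A = 1.
  have mu0' : 0 <= mu^-1 by rewrite invr_ge0 ltW.
  have := integral_exponential_scale _ _ _ _ (@measurableT _ _) mf mu0' A0 fneg fA.
  by rewrite f1 integral_exponential_pdf ?invr_gt0// mule1 => -[].
move=> A1 x x0; rewrite fA// A1 mul1r; congr (_ * expR _); ring.
Qed.

End PastEntropy.

(** With [s] fixed outside the equivalence, the identity at a single exponent already forces the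
    exponential law. The value of [f] at 0 is left free, as a single point has no mass. *)
Theorem theorem3p4 (R : realType) (f : R -> R) (mu s : R) :
  measurable_fun setT f ->
  (forall x, 0 <= f x) ->
  (forall x, x < 0 -> f x = 0) ->
  (\int[@lebesgue_measure R]_x (f x)%:E = 1)%E ->
  0 < mu -> 1 <= s ->
  ((forall x, 0 < x -> f x = mu^-1 * expR (- x / mu)) <->
   (forall t, 0 < t -> 0 < distF f t ->
      past_entropy_gf f s t
      = (mu * (rev_hazard f t) `^ s * (expR (s * t / mu) - 1) / s)%:E)).
Proof.
move=> mf f0 fneg f1 mu0 s1; split.
  exact: exponential_past_entropy.
exact: past_entropy_exponential.
Qed.
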